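(* Let $\mathbb{H}^2$ (curvature $-1$) be represented by the Beltrami–Klein model on the open unit disk $D$, and let $K\subset D$ be a compact convex set with nonempty interior. Then the hyperbolic perimeter of $K$ is $$\mathcal{P}=\frac12\int_0^{2\pi}w(\varphi)\,d\varphi,\qquad w(\varphi)=\cot\psi_1(\varphi)-\cot\psi_2(\varphi),$$ where $w(\varphi)$ is the Euclidean length of the projection of $K$ from $R(\varphi)$ onto the $\varphi$-normal, i.e. the Euclidean distance between the two points where the two support lines of $K$ through $R(\varphi)$ meet the $\varphi$-normal (extended as a full Euclidean line if necessary).
   Context: Beltrami–Klein model: $D$ with the Hilbert metric $h(P,Q)=\frac12\log\!\left(\frac{|AQ|}{|AP|}\frac{|BP|}{|BQ|}\right)$, where $A,B$ are the points where the Euclidean line $PQ$ meets the unit circle, in order $A,P,Q,B$; this is the hyperbolic plane of curvature $-1$ and the perimeter is the $h$-length of $\partial K$. For $\varphi\in[0,2\pi)$: $R(\varphi)=(\cos\varphi,\sin\varphi)$ (ideal point), $e(\varphi)=(-\sin\varphi,\cos\varphi)$, and the $\varphi$-normal is the Euclidean line $\{t\,e(\varphi):t\in\mathbb{R}\}$ through the origin perpendicular to $OR$. For $X\in D$ let $\psi_X(\varphi)\in(0,\pi)$ be the counterclockwise angle from $e(\varphi)$ to the direction of $X-R(\varphi)$; $\psi_1(\varphi)=\min_{X\in K}\psi_X(\varphi)$, $\psi_2(\varphi)=\max_{X\in K}\psi_X(\varphi)$. The line through $R(\varphi)$ at counterclockwise angle $\psi$ from $e(\varphi)$ meets the $\varphi$-normal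 at $t=\cot\psi$. *)

(* Defs.v *)
From HB Require Import structures.
From mathcomp Require Import all_boot all_order all_algebra.
From mathcomp Require Import all_classical all_reals all_analysis.
Set Implicit Arguments. Unset Strict Implicit. Unset Printing Implicit Defensive.
Import Order.TTheory GRing.Theory Num.Theory.
Import numFieldNormedType.Exports.
Local Open Scope classical_set_scope.
Local Open Scope ring_scope.

Section Klein.
Variable R : realType.
Notation pt := (R * R)%type.

Definition padd (P Q : pt) : pt := (P.1 + Q.1, P.2 + Q.2).
Definition psub (P Q : pt) : pt := (P.1 - Q.1, P.2 - Q.2).
Definition pscale (t : R) (P : pt) : pt := (t * P.1, t * P.2).
Definition dot (P Q : pt) : R := P.1 * Q.1 + P.2 * Q.2.
Definition enorm (P : pt) : R := Num.sqrt (dot P P).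
Definition edist (P Q : pt) : R := enorm (psub P Q).

Definition disk : set pt := [set P | dot P P < 1].

(* Endpoints A, B of the chord of the unit circle through P, Q (P <> Q):
   A = P + tA (Q - P), B = P + tB (Q - P) where tA < 0 < 1 < tB are the
   two roots of |P + t (Q - P)|^2 = 1; so A, P, Q, B are in this order. *)
Definition chord_tA (P Q : pt) : R :=
  let u := psub Q P in let a := dot u u in let b := dot P u in
  let c := dot P P - 1 in (- b - Num.sqrt (b ^+ 2 - a * c)) / a.
Definition chord_tB (P Q : pt) : R :=
  let u := psub Q P in let a := dot u u in let b := dot P u in
  let c := dot P P - 1 in (- b + Num.sqrt (b ^+ 2 - a * c)) / a.
Definition chord_A (P Q : pt) : pt := padd P (pscale (chord_tA P Q) (psub Q P)).
Definition chord_B (P Q : pt) : pt := padd P (pscale (chord_tB P Q) (psub Q P)).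

Definition hilbert (P Q : pt) : R :=
  if P == Q then 0 else
  2^-1 * ln ((edist (chord_A P Q) Q / edist (chord_A P Q) P) *
             (edist (chord_B P Q) P / edist (chord_B P Q) Q)).

Definition curve_length (gamma : R -> pt) : \bar R :=
  ereal_sup [set x | exists (n : nat) (t : nat -> R),
     [/\ t 0%N = 0, t n = 1, (forall i, (i < n)%N -> t i <= t i.+1) &
          x = (\sum_(i < n) hilbert (gamma (t i)) (gamma (t i.+1)))%:E]].

Definition boundary (K : set pt) : set pt := closure K `\` interior K.

Definition boundary_param (K : set pt) (gamma : R -> pt) : Prop :=
  {within `[0, 1]%classic, continuous gamma} /\ gamma 0 = gamma 1 /\
  {in `[0, 1[%classic &, injective gamma} /\
  gamma @` `[0, 1]%classic = boundary K.

Definition is_h_perimeter (K : set pt) (p : \bar R) : Prop :=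
  (exists gamma, boundary_param K gamma) /\
  forall gamma, boundary_param K gamma -> curve_length gamma = p.

Definition Rpt (phi : R) : pt := (cos phi, sin phi).
Definition evec (phi : R) : pt := (- sin phi, cos phi).

(* counterclockwise angle from e(phi) to X - R(phi); for X in D the vector
   X - R(phi) points to the left of e(phi), so this angle lies in (0, pi)
   and is given by acos of the normalized scalar product. *)
Definition psiX (X : pt) (phi : R) : R :=
  let d := psub X (Rpt phi) in acos (dot d (evec phi) / enorm d).

Definition psi1 (K : set pt) (phi : R) : R := inf [set psiX X phi | X in K].
Definition psi2 (K : set pt) (phi : R) : R := sup [set psiX X phi | X in K].

Definition cot (x : R) : R := cos x / sin x.

Definition width (K : set pt) (phi : R) : R :=
  cot (psi1 K phi) - cot (psi2 K phi).

End Klein.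

(* Main.v *)
(* Projecting X from the ideal point R(phi) to the phi-normal gives the
   coordinate f(phi, X) = cot psi_X(phi) = (X.e) / (1 - X.R).  Since R' = e, the
   function ln (1 - X.R(phi)) is an antiderivative of - f(., X), and
   f(., P) - f(., Q) changes sign exactly at the two ideal endpoints of the line
   PQ; integrating over the two arcs gives
     int_0^(2 pi) |f(phi, P) - f(phi, Q)| dphi = 4 h(P, Q).
   Summed over an inscribed polygon, the left-hand side becomes the integral of
   variation sums of f(phi, gamma).  A line through R(phi) that meets the interior
   of K meets its boundary at most twice, so the total variation of f(phi, gamma) is
   2 w(phi); it is the limit of the variation sums over uniform partitions, and
   Fatou's lemma exchanges limit and integral.  A boundary parametrization exists
   because the inverse of the radius of K seen from an interior point is a
   Lipschitz function of the direction. *)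
Require Import Defs.
From HB Require Import structures.
From mathcomp Require Import all_boot all_order all_algebra.
From mathcomp Require Import all_classical all_reals all_analysis.
From mathcomp Require Import measurable_realfun ring lra.
Import Order.TTheory GRing.Theory Num.Theory.
Import numFieldNormedType.Exports.
Local Open Scope classical_set_scope.
Local Open Scope ring_scope.

Set Implicit Arguments. Unset Strict Implicit. Unset Printing Implicit Defensive.

(** * Projection from an ideal point to the normal, and its link with the angles [psiX] *)

Section Projection.
Variable R : realType.
Implicit Types (P Q X : R * R) (phi : R).

(** For [X] in the disk, [hden X phi] is its Euclidean distance to the tangent of the unit circle at
    R(phi), and [hnum X phi] is its component along e(phi). *)
Definition hden X phi := 1 - (X.1 * cos phi + X.2 * sin phi).
Definition hnum X phi := X.2 * cos phi - X.1 * sin phi.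
Definition nproj X phi := hnum X phi / hden X phi.

(** Expand |X - R(phi)|^2 >= 0 with |R(phi)| = 1. *)
Lemma hden_ge X phi : (1 - dot X X) / 2 <= hden X phi.
Proof.
rewrite /hden /dot; have := cos2Dsin2 phi.
have := sqr_ge0 (X.1 - cos phi); have := sqr_ge0 (X.2 - sin phi); lra.
Qed.

Lemma hden_gt0 X phi : disk X -> 0 < hden X phi.
Proof. by rewrite /disk /= => h; apply: lt_le_trans (hden_ge X phi); lra. Qed.

(** Pythagoras: in the orthonormal frame R(phi), e(phi) the vector X - R(phi) has coordinates
    [- hden X phi] and [hnum X phi]. *)
Lemma hnum2Dhden2 X phi :
  hnum X phi ^+ 2 + hden X phi ^+ 2 =
  dot (psub X (Rpt phi)) (psub X (Rpt phi)).
Proof.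
rewrite /hnum /hden /dot /psub /Rpt /=; have := cos2Dsin2 phi => h.
have h2 : (sin phi) ^+2 = 1 - cos phi ^+ 2 by lra.
ring: h2.
Qed.

(** The cosine and sine of the angle are [hnum] and [hden] divided by |X - R(phi)|; positivity of
    [hden] keeps the angle strictly between 0 and [pi]. *)
Lemma psiX_spec X phi : disk X ->
  [/\ 0 < psiX X phi, psiX X phi < pi & cot (psiX X phi) = nproj X phi].
Proof.
move=> DX; have hd := hden_gt0 phi DX.
rewrite /psiX; set d := psub X (Rpt phi).
have dn : dot d (evec phi) = hnum X phi.
  by rewrite /d /dot /psub /hnum /evec /Rpt /=; ring.
have n2 : enorm d ^+ 2 = hnum X phi ^+ 2 + hden X phi ^+ 2.
  rewrite hnum2Dhden2 /enorm sqr_sqrtr // -hnum2Dhden2.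
  by rewrite addr_ge0 ?sqr_ge0.
have hd2 : 0 < hden X phi ^+ 2 by rewrite exprn_gt0.
have n0 : 0 < enorm d.
  rewrite lt_neqAle sqrtr_ge0 andbT eq_sym; apply/eqP => e0.
  by move: n2; rewrite e0 expr0n /=; have := sqr_ge0 (hnum X phi); lra.
rewrite dn; set a := hnum X phi / enorm d.
have a2 : a ^+ 2 = 1 - (hden X phi / enorm d) ^+ 2.
  by rewrite /a; field: n2; rewrite gt_eqF.
have q0 : 0 < hden X phi / enorm d by rewrite divr_gt0.
have a1 : -1 < a < 1.
  have q2 : 0 < (hden X phi / enorm d) ^+ 2 by rewrite exprn_gt0.
  by apply/andP; split; nra.
have ha : -1 <= a <= 1 by lra.
have [sa|] := boolP (a \in `[-1, 1]); last by rewrite in_itv /= ha.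
split.
- by apply: acos_gt0; lra.
- by apply: acos_ltpi; lra.
- rewrite /cot acosK // sin_acos // a2 subKr sqrtr_sqr gtr0_norm //.
  rewrite /a /nproj; field.
  by rewrite !gt_eqF.
Qed.

(** The difference [cot a - cot b] equals [sin (b - a) / (sin a * sin b)]. *)
Lemma cot_le (a b : R) : 0 < a < pi -> 0 < b < pi -> (cot a <= cot b) = (b <= a).
Proof.
have key (x y : R) : 0 < x < pi -> 0 < y < pi -> x < y -> cot y < cot x.
  move=> /andP[x0 xp] /andP[y0 yp] xy.
  have sx : 0 < sin x by rewrite sin_gt0_pi // x0.
  have sy : 0 < sin y by rewrite sin_gt0_pi // y0.
  rewrite /cot ltr_pdivrMr // mulrAC ltr_pdivlMr //.
  have : 0 < sin (y - x) by rewrite sin_gt0_pi //; lra.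
  by rewrite sinB; lra.
move=> ha hb; case: (ltgtP b a) => [h|h|->]; last by rewrite lexx.
  by rewrite (ltW (key _ _ hb ha h)).
by rewrite leNgt (key _ _ ha hb h).
Qed.

(* [psi1] is attained at the maximizer of [nproj], since [cot] is decreasing. *)
Lemma width_extremal (K : set (R * R)) phi X Y : K `<=` @disk R ->
  K X -> K Y ->
  (forall Z, K Z -> nproj Y phi <= nproj Z phi <= nproj X phi) ->
  width K phi = nproj X phi - nproj Y phi.
Proof.
move=> KD KX KY ext; have sp Z : K Z -> 0 < psiX Z phi < pi.
  by move=> /KD /(psiX_spec phi)[-> ->].
have sc Z : K Z -> cot (psiX Z phi) = nproj Z phi.
  by move=> /KD /(psiX_spec phi)[].
rewrite /width /psi1 /psi2.
have -> : inf [set psiX Z phi | Z in K] = psiX X phi.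
  apply/eqP; rewrite eq_le; apply/andP; split.
    apply: ge_inf; last by exists X.
    by exists 0 => _ [Z KZ <-]; have /andP[/ltW] := sp Z KZ.
  apply: lb_le_inf; first by exists (psiX X phi); exists X.
  move=> _ [Z KZ <-]; rewrite -cot_le ?sp // !sc //.
  by have /andP[] := ext Z KZ.
have -> : sup [set psiX Z phi | Z in K] = psiX Y phi.
  apply/eqP; rewrite eq_le; apply/andP; split.
    apply: ge_sup; first by exists (psiX Y phi); exists Y.
    move=> _ [Z KZ <-]; rewrite -cot_le ?sp // !sc //.
    by have /andP[] := ext Z KZ.
  apply: ub_le_sup; last by exists Y.
  by exists pi => _ [Z KZ <-]; have /andP[_ /ltW] := sp Z KZ.
by rewrite !sc.
Qed.

(* numerator of [nproj P phi - nproj Q phi]; it vanishes iff R(phi) lies on PQ *)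
Definition pnum P Q phi :=
  (P.2 - Q.2) * cos phi - (P.1 - Q.1) * sin phi + (P.1 * Q.2 - P.2 * Q.1).

(** After clearing denominators, cos^2 + sin^2 = 1 reduces the quadratic terms to the constant
    [P.1 * Q.2 - P.2 * Q.1]. *)
Lemma nprojB P Q phi : disk P -> disk Q ->
  nproj P phi - nproj Q phi = pnum P Q phi / (hden P phi * hden Q phi).
Proof.
move=> /(hden_gt0 phi) hP /(hden_gt0 phi) hQ.
have h2 : (sin phi) ^+2 = 1 - cos phi ^+ 2 by have := cos2Dsin2 phi; lra.
apply: (mulIf (x := hden P phi * hden Q phi)); first by rewrite mulf_neq0 ?gt_eqF.
rewrite mulfVK ?mulf_neq0 ?gt_eqF //.
rewrite (_ : _ * _ = hnum P phi * hden Q phi - hnum Q phi * hden P phi); last first.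
  by rewrite /nproj; field; rewrite ?gt_eqF.
by rewrite /hnum /hden /pnum; ring: h2.
Qed.

End Projection.

(** * Integral of |D| for a derivative D with two sign changes *)

Section IntegralOfNorm.
Variable R : realType.
Local Notation mu := (@lebesgue_measure R).

Lemma FTC_bo (D G : R -> R) (a b : R) : a <= b -> continuous D ->
  (forall x : R, is_derive x 1 G (D x)) ->
  (\int[mu]_(x in `[a, b[) (D x)%:E = (G b - G a)%:E)%E.
Proof.
rewrite le_eqVlt => /predU1P[->|ab] cD dG.
  by rewrite set_itvco0 integral_set0 subrr.
have mD : measurable_fun setT D by exact: continuous_measurable_fun.
rewrite integral_itv_bndo_bndc; last first.
  by apply/measurable_EFinP; apply: measurable_funS mD.
have cG x : {for x, continuous G}.
  by apply: differentiable_continuous; apply/derivable1_diffP; exact: ex_derive.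
rewrite (@continuous_FTC2 _ _ G) // ?EFinB //.
- exact: continuous_subspaceT.
- split=> //.
  + by apply: cvg_at_right_filter; exact: cG.
  + by apply: cvg_at_left_filter; exact: cG.
- by move=> x _; rewrite derive1E; have [_ ->] := dG x.
Qed.

(** The three pieces contribute (G a - G 0) + (G a - G b) + (G T - G b), and [G 0 = G T] cancels the
    ends. *)
Lemma integral_norm_two_sign_changes (D G : R -> R) (a b T : R) :
  0 <= a -> a <= b -> b <= T -> continuous D ->
  (forall x : R, is_derive x 1 G (D x)) -> G 0 = G T ->
  (forall x, 0 <= x <= a -> 0 <= D x) ->
  (forall x, a <= x <= b -> D x <= 0) ->
  (forall x, b <= x <= T -> 0 <= D x) ->
  (\int[mu]_(x in `[0%R, T[) `|D x|%:E = (2 * (G a - G b))%:E)%E.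
Proof.
move=> a0 ab bT cD dG GT D1 D2 D3.
have mN : measurable_fun setT (fun x => `|D x|%:E).
  apply/measurable_EFinP; apply: continuous_measurable_fun => x.
  by apply: cvg_norm; exact: cD.
have split_itv (u v w : R) : u <= v -> v <= w ->
    (\int[mu]_(x in `[u, w[) `|D x|%:E = \int[mu]_(x in `[u, v[) `|D x|%:E +
      \int[mu]_(x in `[v, w[) `|D x|%:E)%E.
  move=> uv vw; rewrite (@itv_bndbnd_setU _ _ (BLeft u) (BLeft v) (BLeft w)) //.
  rewrite ge0_integral_setU //; first exact: measurable_funS mN.
  apply: lt_disjoint => x y; rewrite !in_itv /= => /andP[_ xv] /andP[vy _].
  exact: lt_le_trans xv vy.
rewrite (split_itv 0 a T) //; last exact: le_trans bT.
rewrite (split_itv a b T) //.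
have -> : (\int[mu]_(x in `[0%R, a[) `|D x|%:E = (G a - G 0)%:E)%E.
  rewrite -(FTC_bo a0 cD dG); apply: eq_integral => x.
  by rewrite inE /= in_itv /= => /andP[x0 /ltW xa]; rewrite ger0_norm ?D1 ?x0.
have -> : (\int[mu]_(x in `[b, T[) `|D x|%:E = (G T - G b)%:E)%E.
  rewrite -(FTC_bo bT cD dG); apply: eq_integral => x.
  by rewrite inE /= in_itv /= => /andP[x0 /ltW xa]; rewrite ger0_norm ?D3 ?x0.
have -> : (\int[mu]_(x in `[a, b[) `|D x|%:E = ((- G) b - (- G) a)%:E)%E.
  have cN : continuous (- D) by move=> x; apply: continuousN; exact: cD.
  rewrite -(FTC_bo ab cN).
  apply: eq_integral => x.
  by rewrite inE /= in_itv /= => /andP[x0 /ltW xa]; rewrite ler0_norm ?D2 ?x0.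
have NG x : (- G) x = - G x by [].
by rewrite -!EFinD -GT !NG; congr EFin; ring.
Qed.

End IntegralOfNorm.

(** * The Hilbert distance as an integral over ideal points *)

Section HilbertIntegral.
Variable R : realType.
Local Notation mu := (@lebesgue_measure R).
Implicit Types P Q X : R * R.

Lemma is_derive_hden X (phi : R) : is_derive phi 1 (hden X) (- hnum X phi).
Proof.
rewrite /hden /hnum.
have -> : (fun phi => 1 - (X.1 * cos phi + X.2 * sin phi)) =
  cst 1 - (X.1 \*: @cos R + X.2 \*: @sin R) by [].
by apply: is_derive_eq; rewrite /GRing.scale /=; ring.
Qed.

Lemma is_derive_ln_hden X (phi : R) : disk X ->
  is_derive phi 1 (fun x => ln (hden X x)) (- nproj X phi).
Proof.
move=> DX; have h0 := hden_gt0 phi DX.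
have dl := is_derive1_ln h0.
have := is_derive1_comp dl (is_derive_hden X phi).
by rewrite /nproj mulrN mulrC.
Qed.

Lemma continuous_proj X : disk X -> continuous (nproj X).
Proof.
move=> DX phi; apply: cvgM.
  by apply: cvgB; apply: cvgMl_tmp; [exact: continuous_cos|exact: continuous_sin].
apply: cvgV; first by rewrite gt_eqF ?hden_gt0.
apply: differentiable_continuous; apply/derivable1_diffP.
by have := is_derive_hden X phi => ?; exact: ex_derive.
Qed.

(** The angle is [acos c] or its reflection [2 * pi - acos c], by the sign of [s]; [s < 0] excludes
    [acos c = 0], whence [a < 2 * pi]. *)
Lemma unit_circle_angle (c s : R) : c ^+ 2 + s ^+ 2 = 1 ->
  exists a : R, [/\ 0 <= a, a < 2 * pi, cos a = c & sin a = s].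
Proof.
move=> h; have s2 := sqr_ge0 s; have hc : -1 <= c <= 1 by nra.
have hc' : c \in `[-1, 1] by rewrite in_itv.
have p0 := pi_gt0 R; have a0 := acos_ge0 hc; have ap := acos_lepi hc.
have sE : sin (acos c) = `|s|.
  by rewrite sin_acos // -sqrtr_sqr; congr Num.sqrt; lra.
case: (leP 0 s) => s0.
  exists (acos c); split; [by []|lra|exact: acosK|by rewrite sE ger0_norm].
exists (2 * pi - acos c); split.
- by lra.
- have : acos c != 0.
    by apply/eqP => e; move: sE; rewrite e sin0 => /esym/eqP; rewrite normr_eq0 lt_eqF.
  by rewrite neq_lt ltNge a0 /=; lra.
- by rewrite -cosN opprB -(cosD2pi _) mulr_natl subrK acosK.
- by rewrite -[LHS]opprK -sinN opprB -(sinD2pi _) mulr_natl subrK sE ltr0_norm ?opprK.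
Qed.

(** The left side is twice the signed area of the triangle with vertices at angles [a], [b], [x] on
    the unit circle; the product form displays its sign. *)
Lemma sin3_sum (a b x : R) :
  sin (b - a) + sin (x - b) + sin (a - x) =
  4 * sin ((b - a) / 2) * sin ((x - b) / 2) * sin ((x - a) / 2).
Proof.
have hB : (b - a) / 2 = (x - a) / 2 - (x - b) / 2 by field.
set u := (x - a) / 2 in hB *; set v := (x - b) / 2 in hB *.
rewrite hB; have -> : b - a = (u - v) + (u - v) by rewrite /u /v; field.
have -> : x - b = v + v by rewrite /v; field.
have -> : a - x = - (u + u) by rewrite /u; field.
rewrite sinN !sinD !cosD !sinN !cosN.
have hu := sin2cos2 u; have hv := sin2cos2 v.
ring: hu hv.
Qed.


Lemma enormZ (t : R) (u : R * R) : enorm (pscale t u) = `|t| * enorm u.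
Proof.
rewrite /enorm -sqrtr_sqr -sqrtrM ?sqr_ge0 //; congr Num.sqrt.
by rewrite /dot /pscale /=; ring.
Qed.

Lemma dot_gt0 (u : R * R) : u != (0, 0) -> 0 < dot u u.
Proof.
case: u => x y; rewrite /dot /= xpair_eqE negb_and -!expr2 => /orP[] h.
  by rewrite ltr_pwDl ?sqr_ge0 // lt_neqAle sqr_ge0 eq_sym sqrf_eq0 h.
by rewrite ltr_wpDl ?sqr_ge0 // lt_neqAle sqr_ge0 eq_sym sqrf_eq0 h.
Qed.

(** With u = Q - P, |P + t u|^2 - 1 is a quadratic in [t] with positive leading coefficient,
    negative at 0 and 1 because [P] and [Q] lie in the disk; so its roots enclose [0, 1]. *)
Lemma chord_params P Q : disk P -> disk Q -> P != Q ->
  [/\ chord_tA P Q < 0, 1 < chord_tB P Q,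
      dot (chord_A P Q) (chord_A P Q) = 1 &
      dot (chord_B P Q) (chord_B P Q) = 1].
Proof.
move=> DP DQ PQ.
rewrite /chord_A /chord_B /chord_tA /chord_tB; set u := psub Q P.
set a := dot u u; set b := dot P u; set c := dot P P - 1.
have a0 : 0 < a.
  apply: dot_gt0; apply: contra PQ; case: P Q @u {a b c DP DQ} => [p1 p2] [q1 q2].
  by rewrite /psub /= !xpair_eqE !subr_eq0 => /andP[/eqP-> /eqP->]; rewrite !eqxx.
have c0 : c < 0 by move: DP; rewrite /disk /= /c; lra.
have q0 : a + 2 * b + c < 0.
  move: DQ; rewrite /disk /= => DQ; suff : a + 2 * b + c = dot Q Q - 1 by lra.
  by rewrite /a /b /c /dot /u /psub /=; ring.
have d0 : 0 < b ^+ 2 - a * c by have := sqr_ge0 b; nra.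
set s := Num.sqrt _.
have s2 : s ^+ 2 = b ^+ 2 - a * c by rewrite sqr_sqrtr // ltW.
have s0 : 0 < s by rewrite sqrtr_gt0.
have sE t : a * t ^+ 2 + 2 * b * t + c = 0 ->
    dot (padd P (pscale t u)) (padd P (pscale t u)) = 1.
  move=> h; have -> : 1 = a * t ^+ 2 + 2 * b * t + c + 1 by rewrite h add0r.
  by rewrite /a /b /c /dot /padd /pscale /=; ring.
split.
- rewrite ltr_pdivrMr // mul0r; nra.
- rewrite ltr_pdivlMr // mul1r; nra.
- apply: sE; field: s2; exact: lt0r_neq0.
- apply: sE; field: s2; exact: lt0r_neq0.
Qed.

(** Distances along the line are multiples of |Q - P|, which cancels in the cross ratio. *)
Lemma hilbertE P Q : disk P -> disk Q -> P != Q ->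
  hilbert P Q = 2^-1 * ln (((1 - chord_tA P Q) / (- chord_tA P Q)) *
    (chord_tB P Q / (chord_tB P Q - 1))).
Proof.
move=> DP DQ PQ; have [tA tB _ _] := chord_params DP DQ PQ.
rewrite /hilbert (negbTE PQ); congr (_ * ln _).
set ta := chord_tA P Q in tA *; set tb := chord_tB P Q in tB *.
set u := psub Q P.
have u0 : enorm u != 0.
  rewrite gt_eqF // sqrtr_gt0; apply: dot_gt0; apply: contra PQ; rewrite {}/u.
  case: P Q {ta tb tA tB DP DQ} => [p1 p2] [q1 q2].
  by rewrite /psub /= !xpair_eqE !subr_eq0 => /andP[/eqP-> /eqP->]; rewrite !eqxx.
have dP t : Defs.edist (padd P (pscale t u)) P = `|t| * enorm u.
  by rewrite /Defs.edist -enormZ; congr enorm; rewrite /psub /padd /pscale /=; congr pair; ring.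
have dQ t : Defs.edist (padd P (pscale t u)) Q = `|t - 1| * enorm u.
  rewrite /Defs.edist -enormZ; congr enorm.
  by rewrite /u /psub /padd /pscale /=; congr pair; ring.
rewrite /chord_A /chord_B -/u -/ta -/tb !dP !dQ.
rewrite !(ltr0_norm tA) [`|ta - 1|]ltr0_norm ?[`|tb|]gtr0_norm ?[`|tb - 1|]gtr0_norm; try lra.
field; rewrite u0 /=; apply/andP; split; [|by rewrite lt_eqF].
by rewrite subr_eq0 gt_eqF.
Qed.

Lemma integral_proj_diff P Q : disk P -> disk Q ->
  (\int[mu]_(phi in `[0, 2 * pi[%classic%R) `|nproj P phi - nproj Q phi|%:E =
   (4 * hilbert P Q)%:E)%E.
Proof.
move=> DP DQ; have [->|PQ] := eqVneq P Q.
  rewrite /hilbert eqxx mulr0 integral0_eq // => x _.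
  by rewrite subrr normr0.
have [tA tB nA nB] := chord_params DP DQ PQ.
rewrite hilbertE //.
move: tA tB nA nB; rewrite /chord_A /chord_B.
set u := psub Q P; set ta := chord_tA P Q; set tb := chord_tB P Q.
move=> tA tB nA nB.
have [al [al0 alT ca sa]] := unit_circle_angle nA.
have [be [be0 beT cb sb]] := unit_circle_angle nB.
have nA' : cos al ^+ 2 + sin al ^+ 2 = 1 by exact: cos2Dsin2.
have nB' : cos be ^+ 2 + sin be ^+ 2 = 1 by exact: cos2Dsin2.
have tba : 0 < tb - ta by lra.
(* Here [al] and [be] are the angles of the ideal endpoints A and B. Multiplied by [tb - ta], [pnum]
   is twice the signed area of the triangle A, B, R(phi). *)
have pnumE phi : pnum P Q phi = 4 / (tb - ta) *
    sin ((be - al) / 2) * (sin ((phi - be) / 2) * sin ((phi - al) / 2)).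
  apply: (mulfI (x := tb - ta)); first by rewrite gt_eqF.
  transitivity (sin (be - al) + sin (phi - be) + sin (al - phi)).
    rewrite /pnum !sinB ca sa cb sb /padd /pscale /u /psub /=; ring.
  rewrite sin3_sum; field; exact: lt0r_neq0.
have sgn x : 0 <= x <= 2 * pi -> 0 <= sin (x / 2).
  by move=> /andP[x0 x1]; apply: sin_ge0_pi; apply/andP; split; lra.
have sgnN x : - (2 * pi) <= x <= 0 -> sin (x / 2) <= 0.
  move=> /andP[x0 x1]; rewrite -oppr_ge0 -sinN -mulNr; apply: sgn.
  by apply/andP; split; lra.
pose D (phi : R) : R := nproj P phi - nproj Q phi.
pose G (phi : R) : R := ln (hden Q phi) - ln (hden P phi).
have dG (x : R) : is_derive x 1 G (D x).
  have dP := is_derive_ln_hden x DP; have dQ := is_derive_ln_hden x DQ.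
  by rewrite /G /D; apply: is_derive_eq; rewrite opprK addrC.
have cD : continuous D.
  by move=> x; apply: cvgB; exact: continuous_proj.
have GT : G 0 = G (2 * pi).
  by rewrite /G /hden cos0 sin0 [2 * pi]mulr_natl cos2pi sin2pi.
have DE x : D x = pnum P Q x / (hden P x * hden Q x) by exact: nprojB.
have hpos x : 0 < (hden P x * hden Q x)^-1 by rewrite invr_gt0 mulr_gt0 ?hden_gt0.
have Gab : 2 * (G al - G be) = 4 * (2^-1 *
    ln ((1 - ta) / (- ta) * (tb / (tb - 1)))).
  (* Since R(al) = P + ta u, 1 - P.R(al) = (R(al) - P).R(al) = ta u.R(al). The factor u.R(al) is
     common to [P] and [Q] and drops out of the ratio; likewise at [be]. *)
  have hPa : hden P al = ta * (u.1 * cos al + u.2 * sin al).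
    rewrite /hden -{1}nA' {1}ca {1}sa ca sa /padd /pscale /=; ring.
  have hQa : hden Q al = (ta - 1) * (u.1 * cos al + u.2 * sin al).
    rewrite /hden -{1}nA' ca sa /padd /pscale /u /psub /=; ring.
  have hPb : hden P be = tb * (u.1 * cos be + u.2 * sin be).
    rewrite /hden -{1}nB' cb sb /padd /pscale /=; ring.
  have hQb : hden Q be = (tb - 1) * (u.1 * cos be + u.2 * sin be).
    rewrite /hden -{1}nB' cb sb /padd /pscale /u /psub /=; ring.
  have := hden_gt0 al DP; rewrite hPa => ka.
  have := hden_gt0 be DP; rewrite hPb => kb.
  have ratio : (hden Q al / hden P al) / (hden Q be / hden P be) =
      (1 - ta) / (- ta) * (tb / (tb - 1)).
    rewrite hPa hQa hPb hQb; field.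
    by apply/and5P; split=> //; apply/eqP=> h; move: ka kb; rewrite ?h; lra.
  have lnB (x y : R) : 0 < x -> 0 < y -> ln x - ln y = ln (x / y).
    by move=> x0 y0; rewrite ln_div.
  have -> : 4 * (2^-1 * ln ((1 - ta) / - ta * (tb / (tb - 1)))) =
    2 * ln ((1 - ta) / - ta * (tb / (tb - 1))) by field.
  have r1 : 0 < hden Q al / hden P al by rewrite divr_gt0 ?hden_gt0.
  have r2 : 0 < hden Q be / hden P be by rewrite divr_gt0 ?hden_gt0.
  by congr (2 * _); rewrite -ratio /G -(lnB _ _ r1 r2) !lnB ?hden_gt0.
rewrite -Gab.
have c0 : 0 <= 4 / (tb - ta) by rewrite divr_ge0 // ltW.
(* The two half-angle sines in [pnumE] have equal signs outside the interval between [al] and [be]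
   and opposite signs inside. *)
case: (leP al be) => ab.
  have sab : 0 <= sin ((be - al) / 2) by apply: sgn; apply/andP; split; lra.
  apply: (integral_norm_two_sign_changes al0 ab (ltW beT) cD dG GT).
  + move=> x /andP[x0 x1]; rewrite DE; apply: mulr_ge0; last exact: ltW.
    rewrite pnumE; apply: mulr_ge0; first exact: mulr_ge0.
    by apply: mulr_le0; apply: sgnN; apply/andP; split; lra.
  + move=> x /andP[x0 x1]; rewrite DE; apply: mulr_le0_ge0; last exact: ltW.
    rewrite pnumE; apply: mulr_ge0_le0; first exact: mulr_ge0.
    by apply: mulr_le0_ge0; [apply: sgnN|apply: sgn]; apply/andP; split; lra.
  + move=> x /andP[x0 x1]; rewrite DE; apply: mulr_ge0; last exact: ltW.
    rewrite pnumE; apply: mulr_ge0; first exact: mulr_ge0.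
    by apply: mulr_ge0; apply: sgn; apply/andP; split; lra.
(* For [be < al] the factor [sin ((be - al) / 2)] is nonpositive, so the argument is applied to
   [- D] and [- G] with [be] as the first sign change. *)
have NE (F : R -> R) x : (- F) x = - F x by [].
have -> : 2 * (G al - G be) = 2 * ((- G) be - (- G) al) by rewrite !NE; ring.
have -> : (\int[mu]_(x in `[0, 2 * pi[%classic%R) `|nproj P x - nproj Q x|%:E =
   \int[mu]_(x in `[0, 2 * pi[%classic%R) `|(- D) x|%:E)%E.
  by apply: eq_integral => x _; rewrite NE normrN.
have cDN : continuous (- D) by move=> x; apply: continuousN; exact: cD.
have dGN (x : R) : is_derive x 1 (- G) ((- D) x) by exact: is_deriveN.
have sab : sin ((be - al) / 2) <= 0 by apply: sgnN; apply/andP; split; lra.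
apply: (integral_norm_two_sign_changes be0 (ltW ab) (ltW alT) cDN dGN).
- by rewrite !NE GT.
- move=> x /andP[x0 x1]; rewrite NE oppr_ge0 DE; apply: mulr_le0_ge0; last exact: ltW.
  rewrite pnumE; apply: mulr_le0_ge0; first exact: mulr_ge0_le0.
  by apply: mulr_le0; apply: sgnN; apply/andP; split; lra.
- move=> x /andP[x0 x1]; rewrite NE oppr_le0 DE; apply: mulr_ge0; last exact: ltW.
  rewrite pnumE; apply: mulr_le0; first exact: mulr_ge0_le0.
  by apply: mulr_ge0_le0; [apply: sgn|apply: sgnN]; apply/andP; split; lra.
- move=> x /andP[x0 x1]; rewrite NE oppr_ge0 DE; apply: mulr_le0_ge0; last exact: ltW.
  rewrite pnumE; apply: mulr_le0_ge0; first exact: mulr_ge0_le0.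
  by apply: mulr_ge0; apply: sgn; apply/andP; split; lra.
Qed.

End HilbertIntegral.

(** * Variation bounded by counting level crossings *)

Section Variation.
Variable R : realType.
Local Notation mu := (@lebesgue_measure R).

Lemma le_upto (t : nat -> R) n i j : (forall k, (k < n)%N -> t k <= t k.+1) ->
  (i <= j)%N -> (j <= n)%N -> t i <= t j.
Proof.
move=> tinc; elim: j => [|j IH]; first by rewrite leqn0 => /eqP ->.
rewrite leq_eqVlt => /predU1P[->//|ij] jn.
exact: le_trans (IH ij (ltnW jn)) (tinc _ jn).
Qed.

(* [|g (t i) - g (t i.+1)|] is the measure of the set of levels strictly between
   the two values; each such level is attained in ]t i, t i.+1[, so almost every
   level of ]m, M[ is counted at most twice. *)
Lemma variation_le_two_crossings (g : R -> R) (m M : R) (n : nat) (t : nat -> R) :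
  m <= M -> {within `[0, 1], continuous g} ->
  (forall s, 0 <= s <= 1 -> m <= g s <= M) ->
  (forall c s1 s2 s3, m < c < M ->
     [/\ 0 < s1 < 1, 0 < s2 < 1 & 0 < s3 < 1] ->
     [/\ g s1 = c, g s2 = c & g s3 = c] ->
     [/\ s1 != s2, s2 != s3 & s3 != s1] -> False) ->
  t 0%N = 0 -> t n = 1 -> (forall i, (i < n)%N -> t i <= t i.+1) ->
  \sum_(i < n) `|g (t i) - g (t i.+1)| <= 2 * (M - m).
Proof.
move=> mM cg gb cross t0 tn tinc.
have tI i : (i <= n)%N -> 0 <= t i <= 1.
  by move=> it; rewrite -{1}t0 -tn !(le_upto tinc).
pose lo i := Num.min (g (t i)) (g (t i.+1)).
pose hi i := Num.max (g (t i)) (g (t i.+1)).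
have dE i : `|g (t i) - g (t i.+1)| = hi i - lo i.
  rewrite /hi /lo; case: (leP (g (t i)) (g (t i.+1))) => h.
    by rewrite ler0_norm ?opprB // subr_le0.
  by rewrite gtr0_norm // subr_gt0.
have crossing i c : (i < n)%N -> lo i < c < hi i ->
    exists2 s, t i < s < t i.+1 & g s = c.
  move=> it /andP[lc ch].
  have sub : `[t i, t i.+1] `<=` `[0, 1].
    apply: subset_itv; rewrite bnd_simp.
      by have /andP[] := tI i (ltnW it).
    by have /andP[] := tI _ it.
  have [|s] := IVT (v := c) (tinc _ it) (continuous_subspaceW sub cg).
    by rewrite !ltW.
  rewrite in_itv /= => /andP[ts st] gs; exists s => //.
  rewrite !lt_neqAle ts st !andbT; apply/andP; split; apply/eqP => e; move: lc ch.
    by rewrite /lo /hi -gs e; case: (leP (g s) (g (t i.+1))) => ?; lra.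
  by rewrite /lo /hi -gs -e; case: (leP (g (t i)) (g s)) => ?; lra.
pose A (i : nat) := `]lo i, hi i[%classic.
have loM (i : 'I_n) : m <= lo i.
  have /andP[? _] := gb _ (tI _ (ltnW (ltn_ord i))).
  have /andP[? _] := gb _ (tI _ (ltn_ord i)).
  by rewrite le_min; apply/andP; split.
have hiM (i : 'I_n) : hi i <= M.
  have /andP[_ ?] := gb _ (tI _ (ltnW (ltn_ord i))).
  have /andP[_ ?] := gb _ (tI _ (ltn_ord i)).
  by rewrite ge_max; apply/andP; split.
(* Three indices with [c] in [A i] would give three parameters at level [c], distinct because they
   lie in disjoint open subintervals. *)
have cnt c : m < c < M -> (\sum_(i < n) \1_(A i) c <= 2 :> R).
  move=> hc.
  have -> : \sum_(i < n) \1_(A i) c = #|[pred i : 'I_n | c \in A i]|%:R :> R.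
    rewrite -sum1_card natr_sum [RHS]big_mkcond /=; apply: eq_bigr => i _.
    by rewrite indicE inE; case: (c \in A i).
  rewrite ler_nat leqNgt; apply/negP => /card_gt2P[x [y [z [[]]]]].
  rewrite !inE /A /= !in_itv /= => hx hy hz [xy yz zx].
  have [sx sxI gx] := crossing _ _ (ltn_ord x) hx.
  have [sy syI gy] := crossing _ _ (ltn_ord y) hy.
  have [sz szI gz] := crossing _ _ (ltn_ord z) hz.
  have in01 (i : 'I_n) s : t i < s < t i.+1 -> 0 < s < 1.
    have /andP[? _] := tI _ (ltnW (ltn_ord i)).
    have /andP[_ ?] := tI _ (ltn_ord i).
    by move=> /andP[? ?]; apply/andP; split; lra.
  have dist (i j : 'I_n) s s' : i != j ->
      t i < s < t i.+1 -> t j < s' < t j.+1 -> s != s'.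
    wlog ij : i j s s' / (i < j)%N => [W|].
      move=> ne; case: (ltngtP i j) => h; first exact: W.
        by move=> h1 h2; rewrite eq_sym; apply: (W j i s' s h _ h2 h1); rewrite eq_sym.
      by move/eqP: ne; case; exact: val_inj.
    move=> _ /andP[_ h1] /andP[h2 _].
    by rewrite lt_eqF // (lt_trans h1) // (le_lt_trans _ h2) // (le_upto tinc) // ltnW.
  apply: (cross c sx sy sz hc) => //.
    by split; [exact: in01 sxI|exact: in01 syI|exact: in01 szI].
  by split; [exact: dist sxI syI|exact: dist syI szI|exact: dist szI sxI].
have mA i : measurable (A i) by exact: measurable_itv.
have mI i : measurable_fun `]m, M[ (fun c => (\1_(A i) c)%:E : \bar R).
  by apply/measurable_EFinP; exact: measurable_indic.
have intA (i : 'I_n) :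
    (\int[mu]_(c in `]m, M[) (\1_(A i) c)%:E = (`|g (t i) - g (t i.+1)|)%:E)%E.
  rewrite integral_indic //; last exact: measurable_itv.
  rewrite setIidl; last first.
    by apply: subset_itv; rewrite bnd_simp ?loM ?hiM.
  rewrite /A /= lebesgue_measure_itv /= lte_fin dE; case: ltP => // h.
  have : lo i <= hi i by rewrite /lo /hi le_max ge_min lexx.
  by move=> h'; rewrite (le_anti (introT andP (conj h h'))) subrr.
(* The sum is the integral over the levels of the number of intervals [A i] containing them, and
   that number is at most 2. *)
rewrite -lee_fin -sumEFin.
rewrite (eq_bigr (fun i : 'I_n => \int[mu]_(c in `]m, M[) (\1_(A i) c)%:E)%E); last first.
  by move=> i _; rewrite intA.
rewrite -(@ge0_integral_sum _ _ _ mu _ (measurable_itv `]m, M[) 'I_n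
  (fun i c => (\1_(A i) c)%:E)) //.
have -> : (2 * (M - m))%:E = (\int[mu]_(c in `]m, M[) cst 2%:E c)%E.
  rewrite integral_cst; last exact: measurable_itv.
  rewrite /= lebesgue_measure_itv /= lte_fin.
  case: ltP => h; first by rewrite -EFinM.
  by rewrite (le_anti (introT andP (conj h mM))) subrr mulr0 mule0.
apply: ge0_le_integral => //.
- by move=> c _; apply: sume_ge0 => i _; rewrite lee_fin.
- by apply: (@emeasurable_sum _ _ _ _ _ _ (fun (k : 'I_n) c => (\1_(A k) c)%:E)) => k.
- by move=> c; rewrite /= in_itv /= => hc; rewrite sumEFin lee_fin cnt.
- by move=> k; exact: mI.
Qed.

End Variation.

(** * Interior points of planar convex sets and their intersections with lines *)

Section ConvexGeometry.
Variable R : realType.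
Implicit Types (K : set (R * R)) (P Q X Y o : R * R) (t : R).

Definition seg P Q t : R * R := ((1 - t) * P.1 + t * Q.1, (1 - t) * P.2 + t * Q.2).

Lemma convex_seg K P Q t : convex_set K -> K P -> K Q -> 0 <= t <= 1 ->
  K (seg P Q t).
Proof.
move=> cK KP KQ /andP[t0 t1].
have := cK Q P (Itv01 t0 t1).
rewrite !inE => /(_ KQ KP); congr K.
by rewrite /seg [LHS]addrC.
Qed.

(** Balls of the product structure on [R * R] are open squares. *)
Lemma interior_box K X :
  interior K X <-> exists2 r : R, 0 < r &
    forall Y, `|X.1 - Y.1| < r -> `|X.2 - Y.2| < r -> K Y.
Proof.
split.
  rewrite /interior => /nbhs_ballP[r /= r0 rK]; exists r => // Y h1 h2.
  by apply: rK; split.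
move=> [r r0 rK]; apply/nbhs_ballP; exists r => //= Y [h1 h2].
exact: rK.
Qed.

(** The homothety of centre [Q] and ratio [1 - t] maps a square about [P] to a square about the
    given point; [Z] below is the preimage of [Y]. *)
Lemma interior_seg K P Q t : convex_set K -> interior K P -> K Q -> 0 <= t < 1 ->
  interior K (seg P Q t).
Proof.
move=> cK /interior_box[r r0 rK] KQ /andP[t0 t1].
have u0 : 0 < 1 - t by lra.
apply/interior_box; exists ((1 - t) * r); first exact: mulr_gt0.
move=> Y h1 h2.
pose Z : R * R := ((Y.1 - t * Q.1) / (1 - t), (Y.2 - t * Q.2) / (1 - t)).
have -> : Y = seg Z Q t.
  by rewrite /seg /Z /= [LHS]surjective_pairing; congr pair; field; exact: lt0r_neq0.
apply: convex_seg => //; last by rewrite t0 ltW.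
have aux (p y q : R) : `|(1 - t) * p + t * q - y| < (1 - t) * r ->
    `|p - (y - t * q) / (1 - t)| < r.
  have -> : p - (y - t * q) / (1 - t) = ((1 - t) * p + t * q - y) / (1 - t).
    by field; exact: lt0r_neq0.
  by rewrite normrM normfV (gtr0_norm u0) ltr_pdivrMr // mulrC [r * _]mulrC mulrC.
by apply: rK; rewrite /Z /=; exact: aux.
Qed.

(** A step [e] along the gradient (p, q) raises the form by [e * (p ^+ 2 + q ^+ 2)]; the denominator
    of [e] keeps both coordinate shifts below [r]. *)
Lemma interior_increase K X (p q : R) : interior K X -> 0 < p ^+ 2 + q ^+ 2 ->
  exists2 Y, K Y & p * X.1 + q * X.2 < p * Y.1 + q * Y.2.
Proof.
move=> /interior_box[r r0 rK] pq.
have np := normr_ge0 p; have nq := normr_ge0 q.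
have s0 : 0 < 1 + `|p| + `|q| by lra.
pose e := r / (1 + `|p| + `|q|).
have e0 : 0 < e by rewrite divr_gt0.
have aux (y : R) : `|y| < 1 + `|p| + `|q| -> `|- (e * y)| < r.
  move=> h; rewrite normrN normrM gtr0_norm // /e mulrAC ltr_pdivrMr //.
  by rewrite ltr_pM2l.
exists (X.1 + e * p, X.2 + e * q) => /=; last by nra.
by apply: rK => /=; rewrite opprD addNKr aux //; lra.
Qed.

(** From [o], move towards whichever of [X], [Y] lies across the line. The crossing comes before the
    end of the segment, so it is interior by [interior_seg]. *)
Lemma interior_zero_of_affine K o X Y (p q c : R) : convex_set K ->
  interior K o -> K X -> K Y ->
  p * X.1 + q * X.2 < c < p * Y.1 + q * Y.2 ->
  exists2 Z, interior K Z & p * Z.1 + q * Z.2 = c.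
Proof.
move=> cK io KX KY /andP[hX hY].
have hseg (W : R * R) t : p * (seg o W t).1 + q * (seg o W t).2 =
    (1 - t) * (p * o.1 + q * o.2) + t * (p * W.1 + q * W.2).
  by rewrite /seg /=; ring.
set v := p * o.1 + q * o.2 in hseg *.
have go (W : R * R) : K W -> 0 < (p * W.1 + q * W.2 - c) * (c - v) ->
    exists2 Z, interior K Z & p * Z.1 + q * Z.2 = c.
  move=> KW; set w := p * W.1 + q * W.2; move=> h.
  have ne : w - v != 0 by apply/eqP => e; have := sqr_ge0 (c - v); nra.
  exists (seg o W ((c - v) / (w - v))); last by rewrite hseg -/w; field.
  apply: interior_seg => //.
  move: h; case: (ltP v c) => vc h.
    have wv : 0 < w - v by nra.
    by rewrite divr_ge0 ?ltr_pdivrMr ?mul1r; nra.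
  have wv : w - v < 0 by nra.
  by rewrite ler_ndivlMr ?ltr_ndivrMr ?mul1r ?mul0r; nra.
case: (ltgtP v c) => vc; last by exists o.
- by apply: (go Y) => //; rewrite mulr_gt0 ?subr_gt0.
- by apply: (go X) => //; rewrite nmulr_lgt0 subr_lt0.
Qed.

(** The line has points of [K] strictly on both sides, so it contains an interior point [Z]; each of
    the two rays from [Z] carries at most one boundary point. *)
Lemma line_meets_boundary_twice K o X Y A B C (p q c : R) :
  convex_set K -> interior K o -> K X -> K Y ->
  p * X.1 + q * X.2 < c < p * Y.1 + q * Y.2 ->
  (K `\` interior K) A -> (K `\` interior K) B -> (K `\` interior K) C ->
  [/\ p * A.1 + q * A.2 = c, p * B.1 + q * B.2 = c & p * C.1 + q * C.2 = c] ->
  [/\ A != B, B != C & C != A] -> False.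
Proof.
move=> cK io KX KY hc bA bB bC [eA eB eC] [AB BC CA].
have [Z iZ eZ] := interior_zero_of_affine cK io KX KY hc.
have n0 : 0 < p ^+ 2 + q ^+ 2.
  have [p0|] := eqVneq p 0; last first.
    by move=> p0; rewrite ltr_pwDl ?sqr_ge0 // lt_neqAle sqr_ge0 eq_sym sqrf_eq0 p0.
  have [q0|] := eqVneq q 0; first by move: hc; rewrite p0 q0; lra.
  by move=> q0; rewrite ltr_wpDl ?sqr_ge0 // lt_neqAle sqr_ge0 eq_sym sqrf_eq0 q0.
pose s (W : R * R) := (- q * (W.1 - Z.1) + p * (W.2 - Z.2)) / (p ^+ 2 + q ^+ 2).
have n0' := lt0r_neq0 n0.
have sE (W : R * R) : p * W.1 + q * W.2 = c ->
    W = (Z.1 - s W * q, Z.2 + s W * p).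
  move=> e; rewrite [LHS]surjective_pairing; congr pair.
    apply: (mulfI n0'); rewrite /s.
    transitivity ((p ^+ 2 + q ^+ 2) * Z.1 - (- q * (W.1 - Z.1) + p * (W.2 - Z.2)) * q).
      have h : p * (p * W.1 + q * W.2) = p * (p * Z.1 + q * Z.2) by rewrite e eZ.
      by move: h; lra.
    by field.
  apply: (mulfI n0'); rewrite /s.
  transitivity ((p ^+ 2 + q ^+ 2) * Z.2 + (- q * (W.1 - Z.1) + p * (W.2 - Z.2)) * p).
    have h : q * (p * W.1 + q * W.2) = q * (p * Z.1 + q * Z.2) by rewrite e eZ.
    by move: h; lra.
  by field.
(* [s] is an affine coordinate on the line, with origin at the interior point [Z];
   two boundary points on the same side of [Z] coincide. *)
have half (V W : R * R) : (K `\` interior K) V -> K W ->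
    p * V.1 + q * V.2 = c -> p * W.1 + q * W.2 = c ->
    0 < s V < s W \/ s W < s V < 0 -> False.
  move=> [KV nV] KW eV eW h; apply: nV.
  have sW : s W != 0.
    by case: h => /andP[h1 h2]; [rewrite gt_eqF // (lt_trans h1)|rewrite lt_eqF // (lt_trans h1)].
  have -> : V = seg Z W (s V / s W).
    have [W1 W2] : W.1 = Z.1 - s W * q /\ W.2 = Z.2 + s W * p.
      by rewrite {1 3}(sE W eW).
    by rewrite [LHS](sE V eV) /seg W1 W2; congr pair; field.
  apply: interior_seg => //; case: h => /andP[h1 h2].
    have sW0 : 0 < s W by exact: lt_trans h1 h2.
    apply/andP; split; first by apply: divr_ge0; exact: ltW.
    by rewrite ltr_pdivrMr // mul1r.
  have sW0 : s W < 0 by exact: lt_trans h1 h2.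
  apply/andP; split; last by rewrite ltr_ndivrMr // mul1r.
  by rewrite ler_ndivlMr // mul0r ltW.
have nz V : (K `\` interior K) V -> p * V.1 + q * V.2 = c -> s V != 0.
  move=> [_ nV] eV; apply/eqP => s0; apply: nV.
  by rewrite (sE V eV) s0 !mul0r subr0 addr0 -surjective_pairing.
have opp V W : (K `\` interior K) V -> (K `\` interior K) W ->
    p * V.1 + q * V.2 = c -> p * W.1 + q * W.2 = c -> V != W -> s V * s W < 0.
  move=> bV bW eV eW VW; rewrite ltNge; apply/negP => h.
  have := nz V bV eV; have := nz W bW eW; rewrite !neq_lt.
  have KV : K V by case: bV. have KW : K W by case: bW.
  have hVW := half V W bV KW eV eW; have hWV := half W V bW KV eW eV.
  have sne : s V != s W.
    by apply: contra VW => /eqP e; rewrite (sE V eV) (sE W eW) e.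
  move: sne; rewrite neq_lt => /orP[] l1 /orP[] l2 /orP[] l3;
    first [nra | by apply: hVW; lra | by apply: hWV; lra].
have h1 := opp A B bA bB eA eB AB; have h2 := opp B C bB bC eB eC BC.
have h3 := opp C A bC bA eC eA CA.
(* Three numbers cannot have pairwise opposite signs: this product is [s B ^+ 2] times [s C * s A],
   which is negative. *)
have : 0 < (s A * s B) * (s B * s C) by rewrite nmulr_rgt0.
by have := sqr_ge0 (s B); nra.
Qed.

End ConvexGeometry.

(** * Variation sums along closed paths and uniform grids *)

Section Polygons.
Variable R : realType.

Lemma path_norm (v : nat -> R) i j : (i <= j)%N ->
  `|v i - v j| <= \sum_(i <= k < j) `|v k - v k.+1|.
Proof.
move=> ij; rewrite distrC -(telescope_sumr _ ij).
by apply: le_trans (ler_norm_sum _ _ _) _; apply: ler_sum => k _; rewrite distrC.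
Qed.

Lemma closed_path_norm (v : nat -> R) n i j : v 0%N = v n ->
  (i <= n)%N -> (j <= n)%N ->
  2 * `|v i - v j| <= \sum_(k < n) `|v k - v k.+1|.
Proof.
wlog ij : i j / (i <= j)%N => [W v0 iN jN|v0 iN jN].
  by case: (leqP i j) => h; [|rewrite distrC]; apply: W => //; exact: ltnW.
rewrite -(big_mkord xpredT (fun k => `|v k - v k.+1|)).
rewrite (big_cat_nat (n := i)) //= (big_cat_nat (m := i) (n := j)) //=.
have h1 := path_norm v (leq0n i); have h2 := path_norm v ij.
have h3 := path_norm v jN.
have : `|v i - v j| <= `|v 0%N - v i| + `|v j - v n|.
  by rewrite -v0 (distrC (v 0%N)) (distrC (v j)); exact: ler_distD.
by lra.
Qed.

Lemma grid_point (s : R) n : 0 <= s <= 1 ->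
  exists2 i, (i <= n.+1)%N & `|s - i%:R / n.+1%:R| < n.+1%:R^-1.
Proof.
move=> /andP[s0 s1]; have n0 : 0 < n.+1%:R :> R by rewrite ltr0n.
have sn : 0 <= s * n.+1%:R by rewrite mulr_ge0 // ltW.
have /andP[h1 h2] := truncn_itv sn.
exists (Num.trunc (s * n.+1%:R)).
  by rewrite -(ler_nat R); apply: le_trans h1 _; rewrite ler_piMl // ltW.
rewrite ltr_norml; apply/andP; split.
  apply: (@lt_le_trans _ _ 0); first by rewrite oppr_lt0 invr_gt0.
  by rewrite subr_ge0 ler_pdivrMr.
set i := Num.trunc _ in h2 *.
have h3 : s < i.+1%:R / n.+1%:R by rewrite ltr_pdivlMr.
by rewrite ltrBlDr; apply: lt_le_trans h3 _; rewrite -[i.+1%:R]nat1r mulrDl mul1r.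
Qed.

End Polygons.

(** * Length of a boundary parametrization as an integral of the width *)

Section Perimeter.
Variable R : realType.
Local Notation mu := (@lebesgue_measure R).
Local Notation D := (`[0, 2 * pi[%classic : set R).
Implicit Types (K : set (R * R)) (X Y : R * R).

Lemma continuous_proj_point X phi : disk X -> {for X, continuous (fun X => nproj X phi)}.
Proof.
move=> DX.
have c1 : {for X, continuous (fun X : R * R => X.1)} by exact: cvg_fst.
have c2 : {for X, continuous (fun X : R * R => X.2)} by exact: cvg_snd.
apply: cvgM.
  by apply: cvgB; apply: cvgMr_tmp.
apply: cvgV; first by rewrite gt_eqF ?hden_gt0.
by apply: cvgB; [exact: cvg_cst|apply: cvgD; apply: cvgMr_tmp].
Qed.

Lemma proj_extremal K phi : K `<=` @disk R -> compact K -> K !=set0 ->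
  exists X Y, [/\ K X, K Y &
    forall Z, K Z -> nproj Y phi <= nproj Z phi <= nproj X phi].
Proof.
move=> KD cK K0.
have cp : {within K, continuous (fun X => nproj X phi)}.
  apply: continuous_in_subspaceT => X /set_mem KX.
  by apply: continuous_proj_point; exact: KD.
have [X /set_mem KX hX] := compact_EVT_max K0 cK cp.
have [Y /set_mem KY hY] := compact_EVT_min K0 cK cp.
exists X, Y; split=> // Z KZ.
by rewrite hX ?hY // inE.
Qed.

(** Multiply by the positive [hden]. The level set is the line [p * x + q * y = c], which passes
    through R(phi). *)
Lemma proj_level X phi c : disk X ->
  let p := c * cos phi - sin phi in let q := c * sin phi + cos phi in
  ((nproj X phi < c) = (p * X.1 + q * X.2 < c)) *
  ((c < nproj X phi) = (c < p * X.1 + q * X.2)) *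
  ((nproj X phi = c) <-> (p * X.1 + q * X.2 = c)).
Proof.
move=> /(hden_gt0 phi) h0 p q.
have e : p * X.1 + q * X.2 - c = hnum X phi - c * hden X phi.
  by rewrite /hnum /hden /p /q; ring.
rewrite /nproj ltr_pdivrMr // ltr_pdivlMr //.
split; [split|split].
- by apply/idP/idP; lra.
- by apply/idP/idP; lra.
- move=> h; have : hnum X phi = c * hden X phi by rewrite -h mulfVK ?gt_eqF.
  by lra.
- move=> e'; apply: (mulIf (x := hden X phi)); first by rewrite gt_eqF.
  by rewrite mulfVK ?gt_eqF //; lra.
Qed.

(** At an interior extremum the linear form of [proj_level] could still be moved past its level
    inside [K]. Its coefficients do not both vanish: their squares add up to [c ^+ 2 + 1]. *)
Lemma proj_extremal_boundary K phi X Y : K `<=` @disk R -> K X -> K Y ->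
  (forall Z, K Z -> nproj Y phi <= nproj Z phi <= nproj X phi) ->
  ~ interior K X /\ ~ interior K Y.
Proof.
move=> KD KX KY ext.
have nrm c : (c * cos phi - sin phi) ^+ 2 + (c * sin phi + cos phi) ^+ 2 = c ^+ 2 + 1.
  by rewrite -[in RHS](cos2Dsin2 phi); have h := sin2cos2 phi; ring: h.
have gt0 c : 0 < c ^+ 2 + 1 :> R by rewrite ltr_wpDl ?sqr_ge0.
split=> iW.
  set c := nproj X phi; have := gt0 c; rewrite -nrm => pq.
  have [Z KZ] := interior_increase iW pq.
  have [[_ h1] h2] := proj_level phi c (KD _ KX).
  have [[_ h3] _] := proj_level phi c (KD _ KZ).
  rewrite (h2.1 erefl) -h3 => h; have /andP[_] := ext Z KZ.
  by rewrite leNgt h.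
set c := nproj Y phi; have := gt0 c.
(* Negating both coefficients turns the minimum into a maximum. *)
rewrite -nrm -[X in X + _]sqrrN -[X in _ + X]sqrrN => pq.
have [Z KZ] := interior_increase iW pq.
have [[_ _] h2] := proj_level phi c (KD _ KY).
have [[h3 _] _] := proj_level phi c (KD _ KZ).
rewrite !mulNr -!opprD ltrN2 (h2.1 erefl) -h3 => h.
have /andP[] := ext Z KZ.
by rewrite leNgt h.
Qed.

Lemma boundary_compact K : compact K -> boundary K = K `\` interior K.
Proof.
move=> cK; rewrite /boundary; congr (_ `\` _).
by symmetry; apply/closure_id; apply: compact_closed => //; exact: norm_hausdorff.
Qed.

Lemma sum_hilbert_integral (v : nat -> R * R) n :
  (forall i, (i <= n)%N -> disk (v i)) ->
  (\int[mu]_(phi in D) (\sum_(i < n) `|nproj (v i) phi - nproj (v i.+1) phi|)%:E =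
   (4 * \sum_(i < n) hilbert (v i) (v i.+1))%:E)%E.
Proof.
move=> vD; rewrite mulr_sumr -sumEFin.
rewrite [RHS](eq_bigr (fun i : 'I_n => \int[mu]_(phi in D)
   `|nproj (v i) phi - nproj (v i.+1) phi|%:E)%E); last first.
  move=> i _; rewrite integral_proj_diff //; apply: vD => //.
  exact: ltnW.
rewrite -(@ge0_integral_sum _ _ _ mu _ (measurable_itv `[0, 2 * pi[) 'I_n
  (fun i phi => `|nproj (v i) phi - nproj (v i.+1) phi|%:E)) //.
  by apply: eq_integral => phi _; rewrite sumEFin.
move=> i; apply/measurable_EFinP; apply: measurable_funTS.
apply: continuous_measurable_fun => x; apply: cvg_norm.
by apply: cvgB; apply: continuous_proj; apply: vD => //; exact: ltnW.
Qed.

Variables (K : set (R * R)) (gamma : R -> R * R).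
Hypotheses (KD : K `<=` @disk R) (cK : compact K) (vK : convex_set K).
Hypotheses (iK : interior K !=set0) (param : boundary_param K gamma).

Let K0 : K !=set0.
Proof. by have [z /interior_subset Kz] := iK; exists z. Qed.

Lemma param_boundary s : 0 <= s <= 1 -> (K `\` interior K) (gamma s).
Proof.
move=> s01; have [_ [_ [_ im]]] := param.
by rewrite -boundary_compact // -im; exists s => //=; rewrite in_itv.
Qed.

Lemma param_disk s : 0 <= s <= 1 -> disk (gamma s).
Proof. by move=> /param_boundary[/KD]. Qed.

Lemma continuous_proj_param phi :
  {within `[0, 1], continuous (fun s => nproj (gamma s) phi)}.
Proof.
have [cg _] := param; apply/subspace_continuousP => s s01.
move/subspace_continuousP : cg => /(_ s s01) cg.
have ds : disk (gamma s) by apply: param_disk; move: s01; rewrite /= in_itv.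
apply: (cvg_comp _ (fun X => nproj X phi) cg); exact: continuous_proj_point.
Qed.

(** Extremal points of the projection are boundary points, so [gamma] passes through them. *)
Lemma width_attained phi : exists s s', [/\ 0 <= s <= 1, 0 <= s' <= 1,
  forall Z, K Z -> nproj (gamma s') phi <= nproj Z phi <= nproj (gamma s) phi &
  width K phi = nproj (gamma s) phi - nproj (gamma s') phi].
Proof.
have [X [Y [KX KY ext]]] := proj_extremal phi KD cK K0.
have [nX nY] := proj_extremal_boundary KD KX KY ext.
have wE := width_extremal KD KX KY ext.
have [_ [_ [_ im]]] := param.
have : boundary K X by rewrite boundary_compact.
have : boundary K Y by rewrite boundary_compact.
rewrite -im => -[s' /=]; rewrite in_itv /= => s'01 eY [s /=].
rewrite in_itv /= => s01 eX; exists s, s'.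
by rewrite eX eY.
Qed.

Lemma width_ge0 phi : 0 <= width K phi.
Proof.
have [s [s' [s01 _ ext ->]]] := width_attained phi.
have [Ks _] := param_boundary s01.
by have /andP[h _] := ext _ Ks; rewrite subr_ge0.
Qed.

Lemma variation_le_width phi n (t : nat -> R) :
  t 0%N = 0 -> t n = 1 -> (forall i, (i < n)%N -> t i <= t i.+1) ->
  \sum_(i < n) `|nproj (gamma (t i)) phi - nproj (gamma (t i.+1)) phi|
    <= 2 * width K phi.
Proof.
move=> t0 tn tinc; have [s [s' [s01 s'01 ext wE]]] := width_attained phi.
rewrite wE.
apply: (variation_le_two_crossings (g := fun s => nproj (gamma s) phi)) => //.
- by have := width_ge0 phi; rewrite wE subr_ge0.
- exact: continuous_proj_param.
- by move=> u /param_boundary[Ku _]; exact: ext.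
(* Three parameters at level [c] would put three boundary points on one line through R(phi), which
   separates strictly the extremal points [gamma s'] and [gamma s]. *)
move=> c s1 s2 s3 /andP[c1 c2] [h1 h2 h3] [e1 e2 e3] [d1 d2 d3].
have cl (u : R) : 0 < u < 1 -> 0 <= u <= 1 by move=> /andP[? ?]; rewrite !ltW.
have lev u := proj_level phi c (param_disk u).
have [z iz] := iK.
(* Parameters in the open interval avoid the coincidence [gamma 0 = gamma 1]. *)
have inj u u' : 0 < u < 1 -> 0 < u' < 1 -> u != u' -> gamma u != gamma u'.
  move=> hu hu'; apply: contra => /eqP e; apply/eqP.
  have [_ [_ [inj _]]] := param.
  by apply: inj e; rewrite inE /= in_itv /=; lra.
have [Ks _] := param_boundary s01; have [Ks' _] := param_boundary s'01.
apply: (line_meets_boundary_twice (K := K) (o := z) (X := gamma s') (Y := gamma s)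
  (A := gamma s1) (B := gamma s2) (C := gamma s3)
  (p := c * cos phi - sin phi) (q := c * sin phi + cos phi) (c := c)) => //.
- have [[_ l1] _] := lev s s01; have [[l2 _] _] := lev s' s'01.
  by rewrite -l1 -l2 c1.
- exact: (param_boundary (cl _ h1)).
- exact: (param_boundary (cl _ h2)).
- exact: (param_boundary (cl _ h3)).
- have eq u : 0 < u < 1 -> nproj (gamma u) phi = c ->
      (c * cos phi - sin phi) * (gamma u).1 + (c * sin phi + cos phi) * (gamma u).2 = c.
    by move=> /cl /lev[_ h] /h.
  by split; apply: eq.
- by split; apply: inj.
Qed.

Let grid n i : R := i%:R / n.+1%:R.

Let gridI n i : (i <= n.+1)%N -> 0 <= grid n i <= 1.
Proof.
move=> h; rewrite /grid divr_ge0 ?ler0n //= ler_pdivrMr ?ltr0n // mul1r.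
by rewrite ler_nat.
Qed.

Let grid_end n : grid n n.+1 = 1.
Proof. by rewrite /grid divff // pnatr_eq0. Qed.

Let grid0 n : grid n 0 = 0. Proof. by rewrite /grid mul0r. Qed.

Let grid_inc n i : (i < n.+1)%N -> grid n i <= grid n i.+1.
Proof. by move=> _; rewrite /grid ler_pM2r ?invr_gt0 ?ltr0n // ler_nat. Qed.

(** The upper bound is [variation_le_width]. For the lower one, grid points near the two extremal
    parameters enter [closed_path_norm]; two errors [e / 4], doubled there, add up to [e]. *)
Lemma variation_grid_cvg phi :
  \sum_(i < n.+1) `|nproj (gamma (grid n i)) phi - nproj (gamma (grid n i.+1)) phi|
    @[n --> \oo] --> 2 * width K phi.
Proof.
apply/cvgrPdist_le => e e0.
have [s [s' [s01 s'01 ext wE]]] := width_attained phi.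
have near_grid u : 0 <= u <= 1 -> \forall n \near \oo, exists2 i,
    (i <= n.+1)%N & `|nproj (gamma u) phi - nproj (gamma (grid n i)) phi| <= e / 4.
  move=> u01; have := @continuous_proj_param phi; move/subspace_continuousP.
  have uI : `[0, 1]%classic u by rewrite /= in_itv.
  move=> /(_ u uI) /cvgrPdist_le /(_ (e / 4)) []; first by rewrite divr_gt0.
  move=> d /= d0 hd.
  near=> n.
  have [i iN hi] := grid_point n u01.
  exists i => //; apply: hd; last by rewrite /= in_itv /=; exact: gridI.
  apply: (lt_le_trans hi).
  near: n.
  have := near_infty_natSinv_lt (PosNum d0).
  by apply: filterS => n /ltW.
near=> n.
have [i iN hi] : exists2 i, (i <= n.+1)%N &
  `|nproj (gamma s) phi - nproj (gamma (grid n i)) phi| <= e / 4.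
  by near: n; exact: near_grid.
have [j jN hj] : exists2 i, (i <= n.+1)%N &
  `|nproj (gamma s') phi - nproj (gamma (grid n i)) phi| <= e / 4.
  by near: n; exact: near_grid.
have up := variation_le_width phi (grid0 n) (grid_end n) (@grid_inc n).
rewrite ger0_norm ?subr_ge0 //.
have [_ [g01 _]] := param.
have cl : nproj (gamma (grid n 0)) phi = nproj (gamma (grid n n.+1)) phi.
  by rewrite grid0 grid_end g01.
have := closed_path_norm (v := fun i => nproj (gamma (grid n i)) phi) cl iN jN.
move: hi hj; rewrite wE !ler_norml => /andP[a1 a2] /andP[b1 b2].
have := ler_norm (nproj (gamma (grid n i)) phi - nproj (gamma (grid n j)) phi).
lra.
Unshelve. all: by end_near.
Qed.

Let variation n phi := \sum_(i < n.+1)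
  `|nproj (gamma (grid n i)) phi - nproj (gamma (grid n i.+1)) phi|.

Let measurable_variation n : measurable_fun D (fun phi => (variation n phi)%:E).
Proof.
apply/measurable_EFinP; apply: measurable_funTS; apply: measurable_sum => i.
apply: continuous_measurable_fun => x; apply: cvg_norm.
by apply: cvgB; apply: continuous_proj; apply: param_disk; apply: gridI => //; exact: ltnW.
Qed.

(** The width is the pointwise limit of half the variation sums, which are measurable in [phi]. *)
Lemma measurable_width : measurable_fun D (fun phi => (width K phi)%:E).
Proof.
apply: (emeasurable_fun_cvg (fun n phi => (2^-1 * variation n phi)%:E)) => [n|phi _].
  apply/measurable_EFinP; apply: measurable_funM => //.
  by apply/measurable_EFinP; exact: measurable_variation.
apply: cvg_EFin; first exact: nearW.
rewrite [X in _ --> X](_ : _ = 2^-1 * (2 * width K phi)); last by rewrite mulKf.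
by apply: cvgMl_tmp; exact: variation_grid_cvg.
Qed.

Lemma curve_length_integral_width : curve_length gamma =
  (2^-1%:E * \int[mu]_(phi in D) (width K phi)%:E)%E.
Proof.
have mD : measurable D by exact: measurable_itv.
have w0 phi : D phi -> (0 <= (width K phi)%:E)%E by rewrite lee_fin width_ge0.
have double : (\int[mu]_(phi in D) (2 * width K phi)%:E =
    2%:E * \int[mu]_(phi in D) (width K phi)%:E)%E.
  under eq_integral => phi _ do rewrite EFinM.
  by rewrite ge0_integralZl //; exact: measurable_width.
have m2 : measurable_fun D (fun phi => (2 * width K phi)%:E).
  apply/measurable_EFinP; apply: measurable_funM => //.
  by apply/measurable_EFinP; exact: measurable_width.
set I := (\int[mu]_(phi in D) (width K phi)%:E)%E in double *.
apply/eqP; rewrite eq_le; apply/andP; split.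
  (* Integrating [variation_le_width] bounds four times each polygon length [H] by [2 * I], whence
     the factor 1/2. *)
  apply: ge_ereal_sup => _ [n [t [t0 tn tinc ->]]].
  have tI i : (i <= n)%N -> 0 <= t i <= 1.
    by move=> h; rewrite -{1}t0 -tn !(le_upto tinc).
  have vD i : (i <= n)%N -> disk (gamma (t i)) by move=> /tI /param_disk.
  have := sum_hilbert_integral (v := gamma \o t) vD.
  set H := \sum_(i < n) _ => e.
  have : ((4 * H)%:E <= 2%:E * I)%E.
    rewrite -double -e; apply: ge0_le_integral => //.
    - by move=> phi _; rewrite lee_fin sumr_ge0.
    - apply/measurable_EFinP; apply: measurable_funTS; apply: measurable_sum => i.
      apply: continuous_measurable_fun => x; apply: cvg_norm.
      by apply: cvgB; apply: continuous_proj; apply: vD => //; exact: ltnW.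
    - by move=> phi _; rewrite lee_fin; exact: variation_le_width.
  rewrite EFinM -lee_pdivlMl // => /le_trans; apply.
  by rewrite muleA -EFinM (_ : 4^-1 * 2 = 2^-1 :> R) //; lra.
rewrite lee_pdivrMl //.
(* The uniform partitions are admissible in the supremum, so each integrated variation is at most
   four times the length; Fatou then passes this to the limit. *)
have H n : ((\int[mu]_(phi in D) (variation n phi)%:E) <= 4%:E * curve_length gamma)%E.
  have vD i : (i <= n.+1)%N -> disk (gamma (grid n i)) by move=> /gridI /param_disk.
  rewrite (sum_hilbert_integral vD) EFinM lee_pmul2l //.
  rewrite /curve_length; apply: ereal_sup_ubound; exists n.+1, (grid n).
  by split=> // i; exact: grid_inc.
have fat := @fatou _ _ _ mu _ mD (fun n phi => (variation n phi)%:E) measurable_variation.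
have limE phi : limn_einf (fun n => (variation n phi)%:E) = (2 * width K phi)%:E.
  have cv : (variation n phi)%:E @[n --> \oo] --> (2 * width K phi)%:E.
    by apply: cvg_EFin; [exact: nearW|exact: variation_grid_cvg].
  by have [-> _] := cvg_limn_einf_sup cv.
have {}fat : (2%:E * I <= 4%:E * curve_length gamma)%E.
  rewrite -double; under eq_integral => phi _ do rewrite -limE.
  apply: le_trans (fat _) _.
    by move=> n phi _; rewrite lee_fin sumr_ge0.
  (* Each tail infimum is at most its first term, to which [H] applies. *)
  rewrite limn_einf_lim; apply: lime_le; first exact: is_cvg_einfs.
  apply: nearW => n; apply: le_trans (H n).
  by apply: ereal_inf_lbound; exists n => /=.
rewrite -(@lee_pmul2l _ 2) // muleA -EFinM.
by rewrite (_ : 2 * 2 = 4 :> R) //; lra.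
Qed.

End Perimeter.

(** * Existence of a boundary parametrization in polar coordinates *)

Lemma continuous_pair (R : realType) (f g : R -> R) (x : R) :
  {for x, continuous f} -> {for x, continuous g} ->
  {for x, continuous (fun t => (f t, g t))}.
Proof.
move=> cf cg.
exact: (@cvg_pair _ _ _ (nbhs x) (nbhs (f x)) (nbhs (g x)) _ _ _ f g cf cg).
Qed.

Section RadialParametrization.
Variable R : realType.
Variable K : set (R * R).
Hypotheses (KD : K `<=` @disk R) (cK : compact K) (vK : convex_set K).
Variables (o : R * R) (r : R).
Hypotheses (r0 : 0 < r).
Hypothesis box : forall Y : R * R, `|o.1 - Y.1| < r -> `|o.2 - Y.2| < r -> K Y.

Let ray (theta t : R) : R * R := (o.1 + t * cos theta, o.2 + t * sin theta).

Let io : interior K o.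
Proof. by apply/interior_box; exists r. Qed.

Let Ko : K o. Proof. exact: interior_subset io. Qed.

(** The parallelogram law bounds the distance between two points of the disk by its diameter. *)
Lemma ray_bounded theta t : 0 <= t -> K (ray theta t) -> t <= 2.
Proof.
move=> t0 /KD; have := KD Ko; rewrite /disk /dot /ray /=.
move: (o.1) (o.2) (cos theta) (sin theta) (cos2Dsin2 theta) => a b c s cs h1 h2.
have t2 : t ^+ 2 = (t * c) ^+ 2 + (t * s) ^+ 2 by rewrite !exprMn -mulrDr cs mulr1.
have := sqr_ge0 (a + a + t * c); have := sqr_ge0 (b + b + t * s).
by nra.
Qed.

(** The admissible [t] in [0, 2] form a compact set, nonempty since [r / 2] belongs to it; its
    maximum is global by [ray_bounded]. *)
Lemma radius_exists theta : exists rho, [/\ 0 < rho, K (ray theta rho) &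
  forall t, 0 <= t -> K (ray theta t) -> t <= rho].
Proof.
pose A := `[0, 2]%classic `&` (ray theta @^-1` K).
have cray : continuous (ray theta).
  have cc (x y : R) : continuous (fun t : R => x + t * y).
    by move=> t; apply: cvgD; [exact: cvg_cst|apply: cvgMr_tmp; exact: cvg_id].
  by move=> t; exact: (continuous_pair (cc o.1 (cos theta) t) (cc o.2 (sin theta) t)).
have clK : closed K by apply: compact_closed => //; exact: norm_hausdorff.
have cA : compact A.
  apply: compact_closedI; first exact: segment_compact.
  by apply: closed_comp => // t _; exact: cray.
have hr : K (ray theta (r / 2)).
  have aux (x y : R) : `|y| <= 1 -> `|x - (x + r / 2 * y)| < r.
    move=> y1; have r2 : r / 2 < r by rewrite ltr_pdivrMr // ltr_pMr // ltr1n.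
    rewrite opprD addNKr normrN normrM gtr0_norm ?divr_gt0 //.
    by apply: le_lt_trans r2; rewrite ler_piMr // divr_ge0 // ltW.
  by apply: box; apply: aux; [exact: cos_max|exact: sin_max].
have r2 : r / 2 <= 2 by apply: ray_bounded hr; rewrite divr_ge0 // ltW.
have Ar : A (r / 2).
  by split=> //; rewrite /= in_itv /= r2 andbT divr_ge0 // ltW.
have [] := @compact_EVT_max _ _ id A _ cA _.
- by exists (r / 2).
- by apply: continuous_subspaceT => x; exact: cvg_id.
move=> c /set_mem[_ Kc] cmax; exists c; split => //.
  by apply: (@lt_le_trans _ _ (r / 2)); [rewrite divr_gt0|apply: cmax; rewrite inE].
move=> t t0 Kt; apply: cmax; rewrite inE; split => //=.
by rewrite in_itv /= t0; exact: ray_bounded Kt.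
Qed.

Lemma radial_parametrization : exists gamma, boundary_param K gamma.
Proof.
have [rho rhoP] := choice radius_exists.
have rho_gt0 a : 0 < rho a by case: (rhoP a).
have rhoK a : K (ray a (rho a)) by case: (rhoP a).
have rho_max a t : 0 <= t -> K (ray a t) -> t <= rho a by case: (rhoP a) => _ _; exact.
(* The radii are chosen angle by angle, so periodicity has to come from maximality. *)
have rho_eq a b : cos a = cos b -> sin a = sin b -> rho a = rho b.
  move=> e1 e2; apply/eqP; rewrite eq_le.
  have ab t : ray a t = ray b t by rewrite /ray e1 e2.
  by apply/andP; split; apply: rho_max; rewrite ?(ltW (rho_gt0 _)) -?ab // ab.
(* Subadditivity of the gauge of [K] about [o], whose value on the unit vector at angle [a] is
   [(rho a)^-1]: the boundary point at angle [a] and the box point [Z], weighted by [l] and [mu],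
   combine to a point of [K] at angle [b]. *)
have inv_lip a b (mu : R) : 0 < mu -> `|cos b - cos a| < mu * r ->
    `|sin b - sin a| < mu * r -> (rho b)^-1 <= (rho a)^-1 + mu.
  move=> m0 h1 h2; set l := (rho a)^-1; have l0 : 0 < l by rewrite invr_gt0.
  have lm0 : 0 < l + mu by rewrite addr_gt0.
  rewrite -[leRHS]invrK lef_pV2 ?posrE ?invr_gt0 //.
  apply: rho_max; first by rewrite invr_ge0 ltW.
  pose Z : R * R := (o.1 + (cos b - cos a) / mu, o.2 + (sin b - sin a) / mu).
  have KZ : K Z.
    by apply: box; rewrite /Z /= opprD addNKr normrN normrM normfV (gtr0_norm m0)
      ltr_pdivrMr // mulrC.
  have -> : ray b (l + mu)^-1 = seg (ray a (rho a)) Z (mu / (l + mu)).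
    have -> : rho a = l^-1 by rewrite invrK.
    by rewrite /ray /seg /Z /=; congr pair; field; rewrite !lt0r_neq0.
  apply: convex_seg => //.
  by rewrite divr_ge0 ?(ltW m0) ?(ltW lm0) //= ler_pdivrMr // mul1r; lra.
have cinv : continuous (fun a => (rho a)^-1).
  move=> a; apply/cvgrPdist_le => e e0.
  have er : 0 < e * r by rewrite mulr_gt0.
  have /cvgrPdist_lt/(_ _ er) hc := @continuous_cos R a.
  have /cvgrPdist_lt/(_ _ er) hs := @continuous_sin R a.
  near=> b.
  have h1 : `|cos a - cos b| < e * r by near: b.
  have h2 : `|sin a - sin b| < e * r by near: b.
  have u1 := inv_lip b a e e0 h1 h2; rewrite distrC in h1; rewrite distrC in h2.
  have u2 := inv_lip a b e e0 h1 h2.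
  by rewrite ler_norml; lra.
have crho : continuous rho.
  move=> a; have -> : rho = fun x => ((rho x)^-1)^-1.
    by apply/funext => x; rewrite invrK.
  apply: cvgV; last exact: cinv.
  by rewrite invr_eq0 gt_eqF.
have p0 : 0 < 2 * pi :> R by rewrite mulr_gt0 // pi_gt0.
pose gamma (s : R) := ray (2 * pi * s) (rho (2 * pi * s)).
have g01 : gamma 0 = gamma 1.
  have [e1 e2] : cos (2 * pi * 0) = cos (2 * pi * 1 : R) /\
      sin (2 * pi * 0) = sin (2 * pi * 1 : R).
    by rewrite mulr0 mulr1 mulr_natl cos0 sin0 cos2pi sin2pi.
  by rewrite /gamma (rho_eq _ _ e1 e2) /ray e1 e2.
exists gamma; split; [|split; [by []|split]].
- apply: continuous_subspaceT => s.
  have cl : {for s, continuous (fun s : R => 2 * pi * s)}.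
    by apply: cvgMl_tmp; exact: cvg_id.
  have cr : {for s, continuous (fun s => rho (2 * pi * s))}.
    by apply: continuous_comp cl _; exact: crho.
  have cc : {for s, continuous (fun s => o.1 + rho (2 * pi * s) * cos (2 * pi * s))}.
    apply: cvgD; [exact: cvg_cst|apply: cvgM; first exact: cr].
    by apply: continuous_comp cl _; exact: continuous_cos.
  have cs : {for s, continuous (fun s => o.2 + rho (2 * pi * s) * sin (2 * pi * s))}.
    apply: cvgD; [exact: cvg_cst|apply: cvgM; first exact: cr].
    by apply: continuous_comp cl _; exact: continuous_sin.
  exact: (continuous_pair cc cs).
(* Equal points have equal radii, hence equal directions, so the sine of half the angle difference
   vanishes; that difference is below [2 * pi] in absolute value. *)
- move=> s s'; rewrite !inE /= !in_itv /= => /andP[s0 s1] /andP[s'0 s'1].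
  rewrite /gamma /ray; set a := 2 * pi * s; set b := 2 * pi * s'.
  move=> [/addrI e1 /addrI e2].
  have sq : rho a ^+ 2 = rho b ^+ 2.
    rewrite -[LHS]mulr1 -(cos2Dsin2 a) mulrDr -!exprMn e1 e2 !exprMn -mulrDr.
    by rewrite cos2Dsin2 mulr1.
  have rab : rho a = rho b.
    by apply/eqP; rewrite -(@eqrXn2 _ 2) ?sq // ltW.
  have rn : rho b != 0 by rewrite gt_eqF.
  move: e1 e2; rewrite rab => /(mulfI rn) e1 /(mulfI rn) e2.
  have c1 : cos (a - b) = 1 by rewrite cosB e1 e2 -!expr2 cos2Dsin2.
  have ab : - (2 * pi) < a - b < 2 * pi by rewrite /a /b; apply/andP; split; nra.
  have : sin ((a - b) / 2) = 0.
    have h : (a - b) / 2 + (a - b) / 2 = a - b by field.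
    have := cosD ((a - b) / 2) ((a - b) / 2); rewrite h c1 -!expr2 cos2sin2 => h'.
    by apply/eqP; rewrite -sqrf_eq0; apply/eqP; lra.
  have sn x : 0 < x < pi -> sin x != 0 :> R by move=> /sin_gt0_pi /lt0r_neq0.
  case: (ltgtP a b) => h hs.
  + have := sn (- ((a - b) / 2)); rewrite sinN hs oppr0 eqxx.
    by move=> /(_ _) h'; have : false by apply: h'; apply/andP; split; lra.
  + have := sn ((a - b) / 2); rewrite hs eqxx.
    by move=> /(_ _) h'; have : false by apply: h'; apply/andP; split; lra.
  + by apply: (mulfI _ h); rewrite gt_eqF.
rewrite boundary_compact //; apply/seteqP; split => [_ [s _ <-]|X [KX nX]].
  split; first exact: rhoK.
  move=> /interior_box[d d0 dK]; rewrite /gamma in dK.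
  set a := 2 * pi * s in dK.
  (* If [gamma s] were interior, a point farther out on the same ray would lie in [K]. *)
  have : rho a + d / 2 <= rho a.
    apply: rho_max; first by have := rho_gt0 a; lra.
    have aux (x y : R) : `|y| <= 1 ->
        `|x + rho a * y - (x + (rho a + d / 2) * y)| < d.
      move=> y1; have d2 : d / 2 < d by rewrite ltr_pdivrMr // ltr_pMr // ltr1n.
      have -> : x + rho a * y - (x + (rho a + d / 2) * y) = - (d / 2 * y) by ring.
      rewrite normrN normrM gtr0_norm ?divr_gt0 //.
      by apply: le_lt_trans d2; rewrite ler_piMr // divr_ge0 // ltW.
    by apply: dK; rewrite /ray /=; apply: aux; [exact: cos_max|exact: sin_max].
  by lra.
(* Conversely, write [X] in polar coordinates about [o]: its distance is at most [rho a], and a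
   smaller one would make [X] interior by [interior_seg]. *)
pose v := psub X o.
have v0 : 0 < dot v v.
  apply: dot_gt0; apply/eqP => /pair_equal_spec[/subr0_eq e1 /subr0_eq e2].
  by apply: nX; rewrite [X]surjective_pairing e1 e2 -surjective_pairing.
set t := Num.sqrt (dot v v); have t0 : 0 < t by rewrite sqrtr_gt0.
have t2 : t ^+ 2 = dot v v by rewrite sqr_sqrtr // ltW.
have [|a [a0 a2 ca sa]] := @unit_circle_angle R (v.1 / t) (v.2 / t).
  rewrite !exprMn -mulrDl exprVn t2 !expr2; apply: mulfV.
  exact: lt0r_neq0.
have tn := lt0r_neq0 t0.
have XE : X = ray a t.
  rewrite /ray ca sa [t * (v.1 / t)]mulrC [t * (v.2 / t)]mulrC !mulfVK //.
  by rewrite [LHS]surjective_pairing /v /psub /= !subrKC.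
have tE : t = rho a.
  apply/eqP; rewrite eq_le; apply/andP; split.
    by apply: rho_max; [exact: ltW|rewrite -XE].
  rewrite leNgt; apply/negP => tr; apply: nX.
  have -> : X = seg o (ray a (rho a)) (t / rho a).
    have := lt0r_neq0 (rho_gt0 a) => rn.
    by rewrite XE /ray /seg /=; congr pair; field.
  apply: interior_seg => //; apply/andP; split; first by apply: divr_ge0; exact: ltW.
  by rewrite ltr_pdivrMr // mul1r.
exists (a / (2 * pi)); first by rewrite /= in_itv /= divr_ge0 ?(ltW p0) //= ler_pdivrMr // mul1r ltW.
by rewrite /gamma mulrC mulfVK ?gt_eqF // -tE XE.
Unshelve. all: by end_near.
Qed.

End RadialParametrization.

Theorem theorem4p1 (R : realType) (K : set (R * R)) :
  K `<=` @disk R -> compact K -> convex_set K -> interior K !=set0 ->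
  is_h_perimeter K
    ((2^-1)%:E * \int[lebesgue_measure]_(phi in `[0, 2 * pi[%classic%R)
                   (width K phi)%:E)%E.
Proof.
move=> KD cK vK iK; split.
  by have [z /interior_box[r r0 box]] := iK; exact: radial_parametrization box.
by move=> gamma; exact: curve_length_integral_width.
Qed.
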